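(* Let $M=\begin{pmatrix}1&1\\1&2\end{pmatrix}$. Then $M$ is image partition regular over $\mathbb N$. For $x\in\mathbb N$ let $\phi(x)=\max\{t\in\omega:2^t\leq x\}$ and for $i\in\{0,1,2,3\}$ let $B_i=\{x\in\mathbb N:\phi(x)\equiv i \pmod 4\}$. Then $B_0$ and $B_2$ are central subsets of $(\mathbb N,+)$, and there do not exist $x,y\in\mathbb N$ such that $M\begin{pmatrix}x\\ y\end{pmatrix}\in B_0\times B_2$.
   Context: $\omega=\{0,1,2,\dots\}$, $\mathbb N=\{1,2,\dots\}$. A $k\times m$ matrix $M$ with rational entries is image partition regular over $\mathbb N$ if whenever $\mathbb N$ is finitely colored, there is some $\vec z\in\mathbb N^m$ such that the entries of $M\vec z$ are in $\mathbb N$ and monochromatic. $\beta\mathbb N$ is the Stone–Čech compactification of the discrete semigroup $(\mathbb N,+)$ (its ultrafilters), with the extended operation ($A\in p+q$ iff $\{x:-x+A\in q\}\in p$), a compact right topological semigroup; $K(\beta\mathbb N)$ is its smallest two-sided ideal. A set $B\subseteq\mathbb N$ is central if $B\in p$ for some idempotent $p\in K(\beta\mathbb N)$. *)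

(* Defs.v *)
From HB Require Import structures.
From mathcomp Require Import all_boot all_order all_algebra.
From mathcomp Require Import boolp classical_sets filter.

Set Implicit Arguments.
Unset Strict Implicit.
Unset Printing Implicit Defensive.

Import GRing.Theory.

Local Open Scope classical_set_scope.
Local Open Scope ring_scope.

(* N = {1, 2, ...} as an additive semigroup *)
Record posn := Posn { posn_val :> nat; posn_gt0 : (0 < posn_val)%N }.

HB.instance Definition _ := [isSub for posn_val].
HB.instance Definition _ := [Choice of posn by <:].

Fact posn_add_subproof (x y : posn) : (0 < (x : nat) + (y : nat))%N.
Proof. by rewrite addn_gt0 posn_gt0. Qed.

Definition posn_add (x y : posn) : posn := Posn (posn_add_subproof x y).

Fact posn_addA : associative posn_add.
Proof. by move=> x y z; apply: val_inj; rewrite /= addnA. Qed.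

Fact posn_addC : commutative posn_add.
Proof. by move=> x y; apply: val_inj; rewrite /= addnC. Qed.

HB.instance Definition _ := Algebra.isAddSemigroup.Build posn posn_addC posn_addA.

Definition rat_of_posn (n : posn) : rat := (n : nat)%:R.

(* The points of beta S, for S discrete, are the ultrafilters on S. *)
Record beta (S : Type) := Beta {
  beta_sets :> set S -> Prop;
  beta_ultra : UltraFilter beta_sets }.

Section BetaSemigroup.
Variable S : addSemigroupType.
Implicit Types (p q : beta S) (A : set S) (I : set (beta S)).

Definition beta_add_sets p q : set_system S :=
  [set A | p [set x | q [set y | A (x + y)]]].

Lemma beta_add_ultra p q : UltraFilter (beta_add_sets p q).
Proof.
have pU := beta_ultra p; have qU := beta_ultra q.
have pF : ProperFilter (beta_sets p) by exact: ultra_proper.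
have qF : ProperFilter (beta_sets q) by exact: ultra_proper.
have addF : ProperFilter (beta_add_sets p q).
  split.
    rewrite /beta_add_sets /= => pq0; apply: (@filter_not_empty _ (beta_sets p)).
    by apply: filterS pq0 => x; exact: filter_not_empty.
  split=> [|A B pA pB|A B sAB pA]; rewrite /beta_add_sets /=.
  - by apply: (@filterS _ (beta_sets p) _ setT) => [x _|]; exact: filterT.
  - apply: (@filterS2 _ (beta_sets p) _ _ _ _ _ pA pB) => x qA qB.
    exact: (@filterI _ (beta_sets q)).
  - by apply: (@filterS _ (beta_sets p) _ _ _ _ pA) => x; apply: filterS => y /sAB.
split=> // G GF sG; apply/seteqP; split=> // A GA.
have [//|pNA] := in_ultra_setVsetC [set x | q [set y | A (x + y)]] pU.
suff GNA : G (~` A).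
  by case: (@filter_not_empty _ G _); rewrite -(setICr A); exact: filterI.
apply: sG; rewrite /beta_add_sets /=; apply: filterS pNA => x /= nqA.
by have [//|] := in_ultra_setVsetC [set y | A (x + y)] qU.
Qed.

Definition beta_add p q : beta S := Beta (beta_add_ultra p q).

HB.instance Definition _ := Algebra.hasAdd.Build (beta S) beta_add.

Definition two_sided_ideal I :=
  I !=set0 /\ forall p q, I p -> I (q + p) /\ I (p + q).

(* K(beta S), as the intersection of all two-sided ideals: it is the smallest
   ideal as soon as it is nonempty, see smallest_ideal_ideal. *)
Definition smallest_ideal : set (beta S) := smallest two_sided_ideal set0.

Lemma smallest_ideal_ideal :
  smallest_ideal !=set0 -> two_sided_ideal smallest_ideal.
Proof.
move=> K0; split=> // p q Kp; split=> I II; have := Kp I II;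
  by case: II => -[_ II] _ /(II _ q)[].
Qed.

Definition central A :=
  exists p : beta S, [/\ smallest_ideal p, p + p = p & p A].

End BetaSemigroup.

(* A rational is an entry "in C" for C a set of positive integers when it
   belongs to rat_of_posn @` C; a finite coloring is a map to some 'I_r. *)
Definition image_partition_regular (k m : nat) (M : 'M[rat]_(k, m)) :=
  forall (r : nat) (c : posn -> 'I_r),
  exists (z : 'cV[posn]_m) (a : 'I_r), forall i : 'I_k,
    (rat_of_posn @` (c @^-1` [set a])) ((M *m map_mx rat_of_posn z) i 0).

Definition M_11_12 : 'M[rat]_2 :=
  \matrix_(i < 2, j < 2) (nth [::] [:: [:: 1; 1]; [:: 1; 2]] i)`_j.

(* trunc_log 2 x is the largest t with 2 ^ t <= x, for x > 0 *)
Definition phi (x : posn) : nat := trunc_log 2 x.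

Definition Bset (i : nat) : set posn := [set x | (phi x = i %[mod 4])%N].

(* Main.v *)
(* B_i contains the dyadic blocks [2^(4m+i), 2^(4m+i+1)), so every finite set
   of integers has a translate inside B_i. Hence some ultrafilter q contains all
   the sets -x + B_i, that is, B_i belongs to every member of the closed left
   ideal beta N + q. This ideal contains a minimal closed left ideal, which lies
   in K(beta N), and by Ellis' theorem has an idempotent element. *)
Require Import Defs.
From mathcomp Require Import all_boot all_order all_algebra.
From mathcomp Require Import boolp classical_sets filter.

Set Implicit Arguments.
Unset Strict Implicit.
Unset Printing Implicit Defensive.

Local Open Scope classical_set_scope.
Local Open Scope ring_scope.

(** * Ultrafilters and compactness of the Stone topology *)

#[local] Instance beta_proper (T : Type) (p : beta T) :
  ProperFilter (beta_sets p).
Proof. by case: p => p pU; exact: ultra_proper. Qed.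

Lemma beta_setC (T : Type) (p : beta T) (A : set T) : p (~` A) <-> ~ p A.
Proof.
split=> [pNA pA|npA]; last by have [] := in_ultra_setVsetC A (beta_ultra p).
by apply: (@filter_not_empty _ p); rewrite -(setICr A); exact: filterI.
Qed.

Lemma beta_eq (T : Type) (p q : beta T) : (forall A, p A -> q A) -> p = q.
Proof.
case: p => [p pU] /= pq.
have {pq} : beta_sets q = p by exact: (@max_filter _ p pU q (beta_proper q) pq).
case: q => [q qU] /= qp; case: _ / qp in pU *.
by congr Beta; exact: Prop_irrelevance.
Qed.

Lemma beta_exists (T : Type) (F : set_system T) :
  ProperFilter F -> exists p : beta T, forall A, F A -> p A.
Proof. by move=> /ultraFilterLemma[G [GU FG]]; exists (Beta GU). Qed.

(* The basic closed sets of the Stone topology on beta T are the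
   [{q | A \in q}]; a closed set is an intersection of these. *)
Definition beta_closed (T : Type) (C : set (beta T)) :=
  forall p : beta T, (forall A, (forall q, C q -> q A) -> p A) -> C p.

Lemma beta_closed_bigcap (T : Type) (F : set (set (beta T))) :
  (forall C, F C -> beta_closed C) -> beta_closed (\bigcap_(C in F) C).
Proof.
move=> Fcl p pF C FC; apply: Fcl => // A CA.
by apply: pF => q Fq; apply: CA; exact: Fq.
Qed.

(** The sets that belong to every point of some member of the chain form a proper filter; by
    closedness, an ultrafilter extending it lies in every member. *)
Lemma beta_compact (T : Type) (F : set (set (beta T))) :
  F !=set0 -> total_on F subset ->
  (forall C, F C -> beta_closed C /\ C !=set0) ->
  (\bigcap_(C in F) C) !=set0.
Proof.
move=> [C0 FC0] Ftot Fcl.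
pose G := [set A | exists2 C, F C & forall q : beta T, C q -> q A].
have GP : ProperFilter G.
  split.
    move=> [C FC C0']; have [_ [q Cq]] := Fcl _ FC.
    exact: (@filter_not_empty _ q _ (C0' _ Cq)).
  split.
  - by exists C0 => // q _; exact: filterT.
  - move=> A B [C FC CA] [D FD DB].
    have [CD|DC] := Ftot _ _ FC FD.
      by exists C => // q Cq; apply: filterI; [exact: CA|exact/DB/CD].
    by exists D => // q Dq; apply: filterI; [exact/CA/DC|exact: DB].
  - by move=> A B AB [C FC CA]; exists C => // q /CA; exact: filterS.
have [p Gp] := beta_exists GP; exists p => C FC; apply: (Fcl _ FC).1 => A CA.
by apply: Gp; exists C.
Qed.

(** Zorn's lemma, used below with [Q] saying subsemigroup or left ideal. It is applied to the
    removed parts [X], since [Zorn_bigcup] provides maximal sets under unions of chains. *)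
Lemma minimal_closed (T : Type) (Q : set (set (beta T))) (C0 : set (beta T)) :
  (forall F : set (set (beta T)), F `<=` Q -> Q (\bigcap_(C in F) C)) ->
  beta_closed C0 -> C0 !=set0 -> Q C0 ->
  exists C, [/\ C `<=` C0, beta_closed C, C !=set0, Q C &
    forall D, D `<=` C -> beta_closed D -> D !=set0 -> Q D -> D = C].
Proof.
move=> Qcap C0cl C0n0 QC0.
pose P (X : set (beta T)) :=
  [/\ beta_closed (C0 `\` X), (C0 `\` X) !=set0 & Q (C0 `\` X)].
have [F FP Ftot|X [[Xcl Xn0 QX] Xmax]] := @Zorn_bigcup _ P.
  (* Including [C0] itself keeps the intersection inside [C0] when the chain [F] is empty. *)
  pose G := [set C | C = C0 \/ exists2 X, F X & C = C0 `\` X].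
  have -> : P (\bigcup_(X in F) X) =
      [/\ beta_closed (\bigcap_(C in G) C), (\bigcap_(C in G) C) !=set0
        & Q (\bigcap_(C in G) C)].
    rewrite /P; suff -> : C0 `\` (\bigcup_(X in F) X) = \bigcap_(C in G) C by [].
    apply/seteqP; split=> [p [C0p NFp] _ [->//|[X FX ->]]|p Gp].
      by split=> // Xp; apply: NFp; exists X.
    split; first by apply: Gp; left.
    move=> [X FX Xp].
    by have [|_ /(_ Xp)] := Gp (C0 `\` X); first by right; exists X.
  have GP C : G C -> [/\ beta_closed C, C !=set0 & Q C].
    by move=> [->//|[X FX ->]]; exact: FP.
  split.
  - by apply: beta_closed_bigcap => C /GP[].
  - apply: beta_compact; [by exists C0; left| |by move=> C /GP[]].
    move=> _ _ [->|[X FX ->]] [->|[Y FY ->]]; [by left|by right; exact: subDsetl|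
      by left; exact: subDsetl|].
    have [XY|YX] := Ftot _ _ FX FY; [right|left]; exact: setDS.
  - by apply: Qcap => C /GP[].
exists (C0 `\` X); split=> [||||D DX Dcl Dn0 QD] //.
apply/seteqP; split=> // p [C0p NXp]; apply: contrapT => NDp.
have DE : C0 `\` ~` D = D.
  by apply/seteqP; split=> [q [_ /contrapT]|q Dq] //; split=> //; have [] := DX _ Dq.
(* The point [p] makes the complement of [D] strictly larger than [X]. *)
apply: (Xmax (~` D)); last by rewrite /P DE.
split=> [q Xq Dq|NDX]; first by have [] := DX _ Dq.
exact/NXp/NDX.
Qed.

(** * Idempotents, minimal closed left ideals and thick sets *)

Section Central.
Variable S : addSemigroupType.
Implicit Types (p q r : beta S) (L : set (beta S)).

Lemma beta_addA p q r : p + (q + r) = p + q + r.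
Proof.
apply: beta_eq => A; apply: (@filterS _ p) => x; apply: (@filterS _ q) => y.
by apply: (@filterS _ r) => z /=; rewrite Algebra.addrA.
Qed.

(** Right translation by [q] is continuous, so it maps compact sets to compact sets. *)
Lemma beta_closed_translate L q :
  beta_closed L -> beta_closed [set r + q | r in L].
Proof.
move=> Lcl p pLq.
(* An ultrafilter [r] containing [G] lies in [L] and satisfies [r + q = p]. *)
pose G := [set B : set S | exists2 A, p A & forall r, L r -> (r + q)%R A -> r B].
have GP : ProperFilter G.
  split.
    move=> [A pA A0]; apply: (proj1 (beta_setC p A)) pA.
    apply: pLq => _ [r Lr <-]; apply/beta_setC => /(A0 _ Lr).
    exact: filter_not_empty.
  split.
  - by exists setT => [|r Lr _]; exact: filterT.
  - move=> B C [A pA AB] [A' pA' AC]; exists (A `&` A'); first exact: filterI.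
    move=> r Lr rAA'; apply: filterI.
      by apply: AB => //; apply: filterS rAA' => x [].
    by apply: AC => //; apply: filterS rAA' => x [].
  - by move=> B C BC [A pA AB]; exists A => // r Lr /(AB _ Lr); exact: filterS.
have [r Gr] := beta_exists GP; exists r.
  apply: Lcl => B LB; apply: Gr; exists setT => [|r' Lr' _]; first exact: filterT.
  exact: LB.
by apply/esym/beta_eq => A pA; apply: Gr; exists A.
Qed.

Lemma beta_closed_stabilizer L p q :
  beta_closed L -> beta_closed [set r | L r /\ r + q = p].
Proof.
move=> Lcl s sL; split; first by apply: Lcl => A LA; apply: sL => r [/LA].
by apply/esym/beta_eq => A pA; apply: sL => r [_ rqp]; rewrite -rqp in pA.
Qed.

(** Ellis' argument: for [p] in a minimal closed subsemigroup [T], first [T + p = T], so some [e] in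
    [T] has [e + p = p]; then the [r] in [T] with [r + p = p] form all of [T], and [p] is one of
    them. *)
Lemma idempotent_exists L : beta_closed L -> L !=set0 ->
  (forall p q, L p -> L q -> L (p + q)) -> exists2 p, L p & p + p = p.
Proof.
move=> Lcl Ln0 Ladd.
pose Q := [set C : set (beta S) | forall p q, C p -> C q -> C (p + q)].
have [|T [TL Tcl Tn0 Tadd Tmin]] := @minimal_closed _ Q L _ Lcl Ln0 Ladd.
  by move=> F FQ p q Fp Fq C FC; apply: FQ => //; [exact: Fp|exact: Fq].
have [p Tp] := Tn0.
have TpT : [set r + p | r in T] = T.
  apply: Tmin.
  - by move=> _ [r Tr <-]; exact: Tadd.
  - exact: beta_closed_translate.
  - by exists (p + p); exists p.
  - move=> _ _ [r Tr <-] [s Ts <-]; exists (r + p + s); last by rewrite -beta_addA.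
    by apply: (Tadd _ _ _ Ts); exact: Tadd.
have : T p by []; rewrite -{1}TpT => -[e Te ep].
have stabT : [set r | T r /\ r + p = p] = T.
  apply: Tmin.
  - by move=> r [].
  - exact: beta_closed_stabilizer.
  - by exists e.
  - by move=> r s [Tr rp] [Ts sp]; split; [exact: Tadd|rewrite -beta_addA sp].
by exists p; [exact: TL|move: Tp; rewrite -{1}stabT => -[]].
Qed.

Lemma minimal_idempotent_exists L : beta_closed L -> L !=set0 ->
  (forall p q, L q -> L (p + q)) ->
  exists p, [/\ L p, smallest_ideal p & p + p = p].
Proof.
move=> Lcl Ln0 Lideal.
pose Q := [set C : set (beta S) | forall p q, C q -> C (p + q)].
have [|M [ML Mcl Mn0 Mideal Mmin]] := @minimal_closed _ Q L _ Lcl Ln0 Lideal.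
  by move=> F FQ p q Fq C FC; apply: FQ => //; exact: Fq.
have [p Mp pp] := idempotent_exists Mcl Mn0 (fun p q _ => Mideal p q).
exists p; split=> //; first exact: ML.
move=> I [[[i Ii] Iideal] _].
(* For [i] in a two-sided ideal [I], the left ideal generated by [i + p] lies in both [M] and [I];
   minimality makes it [M], whence [p] is in [I]. *)
have MiE : [set r + (i + p) | r in setT] = M.
  apply: Mmin.
  - by move=> _ [r _ <-]; apply/Mideal/Mideal.
  - exact: beta_closed_translate.
  - by exists (i + (i + p)); exists i.
  - by move=> r _ [s _ <-]; exists (r + s) => //; rewrite -beta_addA.
move: Mp; rewrite -MiE => -[r _ <-].
by apply: (proj1 (Iideal _ _ _)); exact: (proj2 (Iideal _ _ _)).
Qed.

Lemma thick_central (A : set S) :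
  (forall s : seq S, exists y, forall x, x \in s -> A (x + y)) -> central A.
Proof.
move=> Athick.
(* The filter generated by the translates [-x + A]; thickness is exactly their finite intersection
   property. *)
pose F := [set B : set S |
  exists s : seq S, forall y, (forall x, x \in s -> A (x + y)) -> B y].
have FP : ProperFilter F.
  split; first by move=> [s sB]; have [y /sB] := Athick s.
  split.
  - by exists [::].
  - move=> B C [s sB] [t tC]; exists (s ++ t) => y sty.
    by split; [apply: sB|apply: tC] => x xs; apply: sty; rewrite mem_cat xs ?orbT.
  - by move=> B C BC [s sB]; exists s => y /sB /BC.
have [q Fq] := beta_exists FP.
have Aq x : q [set y | A (x + y)].
  by apply: Fq; exists [:: x] => y; apply; rewrite mem_head.
have [|||p [[r _ <-] Kp pp]] := @minimal_idempotent_exists [set r + q | r in setT].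
- exact: beta_closed_translate.
- by exists (q + q); exists q.
- by move=> r _ [s _ <-]; exists (r + s) => //; rewrite -beta_addA.
exists (r + q); split=> //.
(* [A] is in [r + q] for every [r], because [-x + A] is in [q] for all [x]. *)
by apply: (@filterS _ r _ setT) => [x _|]; [exact: Aq|exact: filterT].
Qed.

End Central.

(** * Dyadic blocks and the matrix *)

Lemma Bset_central (i : nat) : central (Bset i).
Proof.
apply: thick_central => s.
(* This [k] is [i] modulo 4 and at least every [x] in [s], so [x < 2 ^ k] and [x + 2 ^ k] stays in
   the block from [2 ^ k] to [2 ^ k.+1]. *)
pose k := (4 * (\max_(x <- s) (x : nat)) + i)%N.
exists (@Posn (2 ^ k) (expn_gt0 2 k)) => x xs.
have xk : (x < 2 ^ k)%N.
  apply: leq_ltn_trans (ltn_expl k (isT : 1 < 2)%N).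
  apply: leq_trans (leq_bigmax_seq (F := fun x : posn => x : nat) x xs isT) _.
  by rewrite (leq_trans _ (leq_addr _ _)) // leq_pmull.
rewrite /Bset /= /phi (@trunc_log_eq 2 k) //; first by rewrite /k mulnC modnMDl.
by rewrite /= leq_addl expnS mul2n -addnn ltn_add2r.
Qed.

Lemma M_11_12_mul (v : 'cV[rat]_2) :
  (M_11_12 *m v) 0 0 = v 0 0 + v 1 0 /\ (M_11_12 *m v) 1 0 = v 0 0 + v 1 0 *+ 2.
Proof.
have E1 : lift ord0 ord0 = 1 :> 'I_2 by exact: val_inj.
by split; rewrite mxE !big_ord_recl big_ord0 !mxE /= E1 GRing.addr0
  !GRing.mul1r // GRing.mulr_natl.
Qed.

(* M (x, y) runs over the pairs (u, v) with u < v < 2u, and any r + 1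
   consecutive integers above r + 1 contain a monochromatic such pair. *)
Lemma M_11_12_ipr : image_partition_regular M_11_12.
Proof.
move=> r c.
have w_gt0 (i : nat) : (0 < r + 2 + i)%N by rewrite addn2.
pose w i := Posn (w_gt0 i).
have /injectivePn[i [j ij cij]] : ~~ injectiveb (fun i : 'I_r.+1 => c (w i)).
  by apply/negP => /injectiveP /leq_card; rewrite !card_ord ltnn.
wlog lij : i j ij cij / (i < j)%N.
  move=> wl; have [lij|lji|/val_inj eij] := ltngtP i j; first exact: (wl i j).
    by apply: (wl j i); rewrite // eq_sym.
  by rewrite eij eqxx in ij.
have jr := ltn_ord j.
(* Inverting the matrix at [u = w i], [v = w j] gives [y = v - u] and [x = u - y], positive because
   [j - i <= r < u]. *)
have y_gt0 : (0 < j - i)%N by rewrite subn_gt0.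
have x_gt0 : (0 < r + 2 + i - (j - i))%N.
  rewrite subn_gt0 (leq_ltn_trans (leq_subr _ _)) // (leq_trans jr) //.
  by rewrite addn2 !addSn ltnS leqW // leq_addr.
have xy : (r + 2 + i - (j - i) + (j - i) = r + 2 + i)%N.
  by rewrite subnK // ltnW // -subn_gt0.
exists (\col_k (if k == 0 then Posn x_gt0 else Posn y_gt0)), (c (w i)) => k.
have [Mv0 Mv1] := M_11_12_mul
  (map_mx rat_of_posn (\col_k (if k == 0 then Posn x_gt0 else Posn y_gt0))).
case: (unliftP 0 k) => [k'|] ->; last first.
  exists (w i); first by [].
  by rewrite Mv0 !mxE /rat_of_posn /= -GRing.natrD xy.
rewrite (ord1 k') (_ : lift 0 0 = 1); last exact: val_inj.
exists (w j); first exact: esym.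
rewrite Mv1 !mxE /rat_of_posn /= -GRing.mulrnA -GRing.natrD muln2 -addnn addnA xy.
by rewrite -(addnA (r + 2)%N) subnKC // ltnW.
Qed.

(* u = x + y < v = x + 2y < 2u, so phi v is phi u or phi u + 1. *)
Lemma phi_mod4_separated (x y u v : posn) :
  (u : nat) = (x + y)%N -> (v : nat) = (x + y.*2)%N ->
  Bset 0 u -> ~ Bset 2 v.
Proof.
move=> uE vE; rewrite /Bset /= /phi => u0 v2.
have [lo hi] : (trunc_log 2 u <= trunc_log 2 v /\
               trunc_log 2 v <= (trunc_log 2 u).+1)%N.
  split; first by apply: leq_trunc_log; rewrite uE vE leq_add2l -addnn leq_addl.
  rewrite -trunc_log2_double ?posn_gt0 //; apply: leq_trunc_log.
  by rewrite uE vE doubleD leq_add2r -addnn leq_addr.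
(* As [phi u] is 0 modulo 4, [phi v] would be 0 or 1 modulo 4, never 2. *)
move: lo hi u0 v2; rewrite leq_eqVlt => /orP[/eqP<- _ ->//|lo hi].
have -> : trunc_log 2 v = (trunc_log 2 u).+1 by apply/eqP; rewrite eqn_leq hi lo.
by move=> u0; rewrite -addn1 -modnDml u0.
Qed.

Theorem theorem2p15 :
  [/\ image_partition_regular M_11_12,
      central (Bset 0),
      central (Bset 2) &
      ~ exists x y : posn,
          let v := M_11_12 *m \col_(j < 2) [:: rat_of_posn x; rat_of_posn y]`_j in
          ((rat_of_posn @` Bset 0) `*` (rat_of_posn @` Bset 2))
            (v 0 0, v 1 0)].
Proof.
split; [exact: M_11_12_ipr|exact: Bset_central|exact: Bset_central|].
move=> [x [y]] /=.
have [-> ->] := M_11_12_mul (\col_(j < 2) [:: rat_of_posn x; rat_of_posn y]`_j).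
rewrite !mxE /rat_of_posn /= -GRing.mulrnA -!GRing.natrD muln2.
move=> [[u Bu /eqP/=]] + [v Bv /eqP/=].
rewrite !Num.Theory.eqr_nat => /eqP uE /eqP vE.
exact: phi_mod4_separated uE vE Bu Bv.
Qed.
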